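(* Let $G$ be a locally compact group and let $P\subset G$ be a closed subsemigroup containing the identity such that $G=PP^{-1}$ and the interior $\mathrm{Int}(P)$ of $P$ in $G$ is dense in $P$. Let $X$ be the order compactification of $P$. (1) The map $X\ni A\mapsto 1_A\in L^\infty(G)$ is a continuous $P$-equivariant embedding, where $L^\infty(G)$ carries the weak$^*$-topology. (2) The semigroup $P$ satisfies Condition (M): every element in the weak$^*$-closure of $\{1_{P^{-1}a}: a\in P\}$ in $L^\infty(G)$ is of the form $1_A$ for a solid closed subset $A$ of $G$.
   Context: All topological spaces are Hausdorff and second countable. $\mu$ denotes a Haar measure on $G$, and $L^\infty(G)=L^1(G)^*$. Order compactification: let $\mathcal{C}(G)$ be the set of all closed subsets of $G$ with the Vietoris topology, a compact metrizable topology in which (fixing a compatible metric $d$ on $G$) a sequence $(A_n)$ converges to $A$ if and only if $\liminf A_n=\limsup A_n=A$, where $\liminf A_n=\{x:\limsup_n d(x,A_n)=0\}$ and $\limsup A_n=\{x:\liminf_n d(x,A_n)=0\}$. $G$ acts on $\mathcal{C}(G)$ on the right by $Ag=\{ag:a\in A\}$. The order compactification $X$ of $P$ is the closure of $\{P^{-1}a:a\in P\}$ in $\mathcal{C}(G)$; it is invariant under right multiplication by elements of $P$. $P$-equivariance refers to the action $A\mapsto Aa$ on $X$ and to right translation $(f\cdot a)(x)=f(xa^{-1})$ on $L^\infty(G)$ (so that $1_A\cdot a=1_{Aa}$). A subset $A$ of $G$ is solid if its interior $\mathrm{Int}(A)$ is dense in $A$ and the support of $\mu|_A$ is $A$. 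*)

(* Defs.v *)
From HB Require Import structures.
From mathcomp Require Import all_boot all_order all_algebra.
From mathcomp Require Import all_classical all_reals all_analysis.
From mathcomp Require Import finmap ess_sup_inf measurable_realfun.
Set Implicit Arguments.
Unset Strict Implicit.
Unset Printing Implicit Defensive.
Import Order.TTheory GRing.Theory Num.Theory.
Import numFieldNormedType.Exports.
Local Open Scope classical_set_scope.
Local Open Scope ring_scope.

(* The base point carried by [ptopologicalType] plays no role: it is only
   there because the library forms generated sigma-algebras on pointed types. *)
HB.mixin Record isLCSCGroup G & PointedTopological G & Group G := {
  mulg_continuous : continuous (fun x : G * G => (x.1 * x.2)%g) ;
  invg_continuous : continuous (fun x : G => (x^-1)%g) ;
  lcsc_hausdorff : hausdorff_space G ;
  lcsc_second_countable : @second_countable G ;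
  lcsc_locally_compact : locally_compact [set: G]
}.

#[short(type="lcscGroupType")]
HB.structure Definition LCSCGroup :=
  { G of PointedTopological G & Group G & isLCSCGroup G }.

Notation borel G := (g_sigma_algebraType (@open G)).

Section Linf_classes.
Context d (T : measurableType d) (R : realType).
Variable mu : {measure set T -> \bar R}.

Definition Linf := LspaceType mu (leey 1).
Definition L1 := LspaceType1 mu.

HB.instance Definition _ := gen_eqMixin Linf.
HB.instance Definition _ := gen_choiceMixin Linf.
HB.instance Definition _ := gen_eqMixin L1.
HB.instance Definition _ := gen_choiceMixin L1.

Lemma Linf_finite_norm (f : Linf) : finite_norm mu +oo (f : T -> R).
Proof. by case: f => f [[]]. Qed.

(* [g] is integrable and [f] is essentially bounded, so the product of the
   two representatives is integrable.  The spaces are those of real-valued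
   functions. *)
Definition pairing (f : Linf) : {ptws L1 -> R} :=
  fun g => \int[mu]_x (f x * g x).

(* [Linf] with the coarsest topology making [f |-> pairing f g] continuous for
   every [g : L1]. *)
Definition Linf_weakstar : Type := initial_topology pairing.
HB.instance Definition _ := Topological.on Linf_weakstar.

Section class.
Variables (f : {mfun T >-> measurableTypeR R}) (ff : finite_norm mu +oo f).

Let cls : {mfun_ mu, T >-> measurableTypeR R} :=
  (\pi_({mfun_ mu, T >-> measurableTypeR R}) f)%qT.

Lemma repr_class_ae : ae_eq mu setT (cls : T -> R) f.
Proof.
have : ((repr cls) = f %[mod {mfun_ mu, T >-> measurableTypeR R}])%qT.
  by rewrite reprK.
by move/eqP; rewrite eqmodE => /asboolP.
Qed.

Lemma class_finite_norm : finite_norm mu +oo cls.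
Proof.
move: ff; rewrite /finite_norm unlock /=; case: ifPn => // _.
set a := ess_sup _ _; set b := ess_sup _ _; suff -> : a = b by [].
apply/esym/eq_ess_sup; move: repr_class_ae; apply: filterS => x /(_ I) /= h.
by rewrite h.
Qed.

HB.instance Definition _ :=
  isFinLebesgue.Build d T R mu +oo%E (leey 1) cls class_finite_norm.

Definition Linf_class : Linf := [the LspaceType mu (leey 1) of cls].

End class.

Lemma Linf_eqP (f g : Linf) : f = g <-> ae_eq mu setT (f : T -> R) g.
Proof.
split=> [->|]; first exact: ae_eq_refl.
case: f g => [f [[Pf]]] [g [[Pg]]] fg.
have fgE : f = g by rewrite -[f]reprK -[g]reprK; apply/eqP/ae_eqP.
by case: _ / fgE Pg {fg} => Pg; rewrite (Prop_irrelevance Pf Pg).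
Qed.

Lemma Linf_classE (f : {mfun T >-> measurableTypeR R}) ff :
  ae_eq mu setT (@Linf_class f ff : T -> R) f.
Proof. exact: repr_class_ae. Qed.

End Linf_classes.

Record closedSet (T : topologicalType) := ClosedSet {
  cset :> set T ;
  cset_closed : closed cset
}.

Section fell.
Context (T : topologicalType).

HB.instance Definition _ := gen_eqMixin (closedSet T).
HB.instance Definition _ := gen_choiceMixin (closedSet T).

Lemma closedSet_inj (A B : closedSet T) : A = B :> set T -> A = B.
Proof.
case: A B => [A cA] [B cB] /= AB.
by case: _ / AB cB => cB; rewrite (Prop_irrelevance cA cB).
Qed.

Definition hit (U : set T) := [set A : closedSet T | A `&` U !=set0].
Definition miss (K : set T) := [set A : closedSet T | A `&` K = set0].

(* The Vietoris topology on the closed subsets of a locally compact space,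
   i.e. the one induced by the hyperspace of the one-point compactification;
   also called the Fell topology.  [closedSet_cvgP] below gives its convergent
   sequences. *)
Definition vietoris_subbase : set (set (closedSet T)) :=
  [set hit U | U in open] `|` [set miss K | K in compact].

HB.instance Definition _ :=
  isSubBaseTopological.Build (closedSet T) vietoris_subbase id.

Lemma vietoris_subbase_open H : vietoris_subbase H -> open H.
Proof.
move=> sH; exists [set H]; last by rewrite bigcup_set1.
move=> _ ->; exists (fset1 H); last by rewrite set_fset1 bigcap_set1.
by move=> K; rewrite in_fset1 => /eqP ->; exact/mem_set.
Qed.

Lemma cvg_closedSetP (F : set_system (closedSet T)) {FF : Filter F}
    (A : closedSet T) :
  (F --> A) <-> (forall H, vietoris_subbase H -> H A -> F H).
Proof.
split=> [FA H sH HA|h].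
  by apply: FA; apply: open_nbhs_nbhs; split=> //; exact: vietoris_subbase_open.
move=> V; rewrite nbhsE => -[W [[D DB <-] [B DBB BA]] WV].
apply: filterS WV _; have [E0 ED EB] := DB _ DBB.
apply: (filterS (bigcup_sup DBB)); rewrite -EB.
apply: filter_bigI => H HE; apply: h; first exact/set_mem/ED.
by move: BA; rewrite -EB; exact.
Qed.

End fell.

Section sequences.
Context (R : realType) (M : metricType R).

Definition closedSet_liminf (A_ : nat -> set M) : set M :=
  [set x | limn_esup (fun n => edist_inf (A_ n) x) = 0%E].
Definition closedSet_limsup (A_ : nat -> set M) : set M :=
  [set x | limn_einf (fun n => edist_inf (A_ n) x) = 0%E].

Lemma edist_inf_lt (A : set M) x (e : R) :
  (edist_inf A x < e%:E)%E <-> A `&` ball x e !=set0.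
Proof.
split=> [/ereal_inf_lt[_ [a Aa <-] /edist_lt_ball xa]|[a [Aa]]]; first by exists a.
rewrite ballEmdist /= => xae; have d0 := mdist_ge0 x a.
pose r := (mdist x a + e) / 2.
have xr : mdist x a < r by rewrite /r ltr_pdivlMr// mulr_natr mulr2n ltrD2l.
have re : r < e by rewrite /r ltr_pdivrMr// mulr_natr mulr2n ltrD2r.
apply: (@le_lt_trans _ _ r%:E); last by rewrite lte_fin.
apply: (@le_trans _ _ (edist (x, a))).
  by apply: ereal_inf_lbound; exists a.
apply: edist_fin; first exact: le_lt_trans d0 xr.
by rewrite ballEmdist.
Qed.

Lemma limn_esup_eq0 (u : nat -> \bar R) : (forall n, 0 <= u n)%E ->
  limn_esup u = 0%E <-> forall e : R, 0 < e -> \forall n \near \oo, (u n < e%:E)%E.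
Proof.
move=> u0; split=> [lu e e0|h].
  have : (limn_esup u < e%:E)%E by rewrite lu lte_fin.
  move=> /ereal_inf_lt[_ [V nV <-] Ve]; apply: filterS nV => n Vn.
  by apply: le_lt_trans Ve; apply: ereal_sup_ubound; exists n.
have le0 : (limn_esup u <= 0)%E.
  apply/lee_addgt0Pr => e e0; rewrite add0e.
  apply: (@le_trans _ _ (ereal_sup (u @` [set n | u n < e%:E]%E))).
    by apply: ereal_inf_lbound; exists [set n | u n < e%:E]%E => //; exact: h.
  by apply: ge_ereal_sup => _ [n /ltW une <-].
by have [_ ->] := cvg_limn_einf_sup (limn_esup_le_cvg le0 u0).
Qed.

Lemma limn_einf_eq0 (u : nat -> \bar R) : (forall n, 0 <= u n)%E ->
  limn_einf u = 0%E <-> forall (e : R) V, 0 < e -> (\forall n \near \oo, V n) ->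
    exists2 n, V n & (u n < e%:E)%E.
Proof.
move=> u0; rewrite /limn_einf; split=> [/eqP|h].
  rewrite oppe_eq0 => /eqP lu e V e0 nV.
  have : (- e%:E < ereal_sup ((\- u) @` V))%E.
    apply: (@lt_le_trans _ _ 0%E); first by rewrite lteNl oppe0 lte_fin.
    by rewrite -lu; apply: ereal_inf_lbound; exists V.
  by move=> /ereal_sup_gt[_ [n Vn <-]]; rewrite lteN2 => une; exists n.
suff -> : limn_esup (\- u)%E = 0%E by rewrite oppe0.
apply/eqP; rewrite eq_le; apply/andP; split.
  apply: (@le_trans _ _ (ereal_sup ((\- u)%E @` setT))).
    by apply: ereal_inf_lbound; exists setT => //; exact: filterT.
  by apply: ge_ereal_sup => _ [n _ <-]; rewrite leeNl oppe0.
apply: le_ereal_inf_tmp => _ [V nV <-].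
apply/lee_addgt0Pr => e e0; have [n Vn une] := h e V e0 nV.
rewrite -leeBlDr// sub0e; apply: (@le_trans _ _ (- u n)%E).
  by rewrite leeN2 ltW.
by apply: ereal_sup_ubound; exists n.
Qed.

Lemma closedSet_liminfP (A_ : nat -> set M) x : closedSet_liminf A_ x <->
  forall e : R, 0 < e -> \forall n \near \oo, A_ n `&` ball x e !=set0.
Proof.
have u0 n := edist_inf_ge0 (A_ n) x; rewrite /closedSet_liminf /=.
split=> [/(limn_esup_eq0 u0) h e e0|h].
  by apply: filterS (h e e0) => n /edist_inf_lt.
by apply/(limn_esup_eq0 u0) => e e0; apply: filterS (h e e0) => n /edist_inf_lt.
Qed.

Lemma closedSet_limsupP (A_ : nat -> set M) x : closedSet_limsup A_ x <->
  forall (e : R) V, 0 < e -> (\forall n \near \oo, V n) ->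
    exists2 n, V n & A_ n `&` ball x e !=set0.
Proof.
have u0 n := edist_inf_ge0 (A_ n) x; rewrite /closedSet_limsup /=.
split=> [/(limn_einf_eq0 u0) h e V e0 nV|h].
  by have [n Vn /edist_inf_lt] := h e V e0 nV; exists n.
apply/(limn_einf_eq0 u0) => e V e0 nV.
by have [n Vn /edist_inf_lt] := h e V e0 nV; exists n.
Qed.

Lemma closedSet_cvgP (A_ : nat -> closedSet M) (A : closedSet M) :
  locally_compact [set: M] ->
  A_ @ \oo --> A <->
  closedSet_liminf A_ = A /\ closedSet_limsup A_ = A.
Proof.
move=> lcM; split=> [/cvg_closedSetP cA|[liA lsA]].
  have infsup : closedSet_liminf A_ `<=` closedSet_limsup A_.
    move=> x /closedSet_liminfP h; apply/closedSet_limsupP => e V e0 nV.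
    by have [n [Vn An]] := filter_ex (filterI nV (h e e0)); exists n.
  have Ainf : A `<=` closedSet_liminf A_.
    move=> x Ax; apply/closedSet_liminfP => e e0.
    have : \forall n \near \oo, hit (ball x e)° (A_ n).
      apply: (cA (hit (ball x e)°)); first by left; exists (ball x e)° => //;
        exact: open_interior.
      by exists x; split=> //; exact: nbhsx_ballx.
    by apply: filterS => n [y [Ay /interior_subset xy]]; exists y.
  have supA : closedSet_limsup A_ `<=` A.
    move=> x /closedSet_limsupP h; apply: contrapT => nAx.
    have := lcM x I; rewrite withinET => -[K nK [cK clK]].
    have : nbhs x (~` A `&` K).
      apply: filterI => //; apply: open_nbhs_nbhs; split=> //.
      exact/closed_openC/cset_closed.
    move=> /nbhs_ballP[e /= e0 eAK].
    have cC : compact (closure (ball x (e / 2))).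
      apply: (subclosed_compact _ cK); first exact: closed_closure.
      by move=> y /(subset_closure_half e0)/eAK[].
    have : \forall n \near \oo, miss (closure (ball x (e / 2))) (A_ n).
      apply: (cA (miss (closure (ball x (e / 2)))));
        first by right; exists (closure (ball x (e / 2))).
      apply/seteqP; split=> // y [Ay].
      by move=> /(subset_closure_half e0)/eAK[].
    move=> /(h (e / 2) _ (divr_gt0 e0 (ltr0Sn _ 1)))[n An [y [Ay yx]]].
    suff : set0 y by [].
    by rewrite -An; split=> //; exact: subset_closure.
  split; apply/seteqP; split=> //; first exact: subset_trans supA.
  exact: subset_trans infsup.
apply/cvg_closedSetP => _ [[U oU <-]|[K cK <-]].
  move=> [x [Ax Ux]].
  have /nbhs_ballP[e /= e0 eU] : nbhs x U by exact: open_nbhs_nbhs.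
  move: Ax; rewrite -liA => /closedSet_liminfP /(_ _ e0).
  by apply: filterS => n [y [Ay /eU Uy]]; exists y.
move=> AK.
have : \forall n \near \oo, K `<=` (fun x => ~ cset (A_ n) x).
  have /compact_near_coveringP := cK; apply => x Kx.
  have : ~ closedSet_limsup A_ x.
    by rewrite lsA => Ax; suff : set0 x by []; rewrite -AK.
  move=> /closedSet_limsupP; apply: contra_notP => h e V e0 nV.
  apply: contrapT => nex; apply: h.
  exists (ball x e, V); first by split=> //=; exact: nbhsx_ballx.
  move=> [y n] [/= xy Vn] Any; apply: nex; exists n => //.
  by exists y.
apply: filterS => n KA; apply/seteqP; split=> // y [Ay Ky].
exact: KA Ky Ay.
Qed.

End sequences.

Section group.
Context (G : lcscGroupType).
Implicit Types (a : G) (A : closedSet G).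

Lemma mulgr_continuous a : continuous (fun x : G => (x * a)%g).
Proof.
move=> x; apply: (@continuous_comp _ _ _ (fun x : G => (x, a))
  (fun x : G * G => (x.1 * x.2)%g)); last exact: mulg_continuous.
by apply: cvg_pair => //; exact: cvg_cst.
Qed.

Lemma mulgl_continuous a : continuous (fun x : G => (a * x)%g).
Proof.
move=> x; apply: (@continuous_comp _ _ _ (fun x : G => (a, x))
  (fun x : G * G => (x.1 * x.2)%g)); last exact: mulg_continuous.
by apply: cvg_pair => //; exact: cvg_cst.
Qed.

Lemma rmul_setE a (A : set G) :
  [set (x * a)%g | x in A] = (fun x => (x * a^-1)%g) @^-1` A.
Proof.
apply/seteqP; split=> [_ [x Ax <-] /=|x Ax /=]; first by rewrite mulgK.
by exists (x * a^-1)%g => //; rewrite mulgVK.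
Qed.

Lemma lmul_setE a (A : set G) :
  [set (a * x)%g | x in A] = (fun x => (a^-1 * x)%g) @^-1` A.
Proof.
apply/seteqP; split=> [_ [x Ax <-] /=|x Ax /=]; first by rewrite mulKg.
by exists (a^-1 * x)%g => //; rewrite mulVKg.
Qed.

Lemma inv_setE (A : set G) : [set (x^-1)%g | x in A] = (fun x => x^-1)%g @^-1` A.
Proof.
apply/seteqP; split=> [_ [x Ax <-] /=|x Ax /=]; first by rewrite invgK.
by exists (x^-1)%g => //; rewrite invgK.
Qed.

Lemma rmul_closed A a : closed [set (x * a)%g | x in A].
Proof.
rewrite rmul_setE; apply: closed_comp; last exact: cset_closed.
by move=> x _; exact: mulgr_continuous.
Qed.

Lemma inv_closed A : closed [set (x^-1)%g | x in A].
Proof.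
rewrite inv_setE; apply: closed_comp; last exact: cset_closed.
by move=> x _; exact: invg_continuous.
Qed.

Definition cset_rmul A a : closedSet G := ClosedSet (@rmul_closed A a).
Definition cset_inv A : closedSet G := ClosedSet (@inv_closed A).

(* The set of all translates [P^-1 a] with [a] in [P]. *)
Definition translates (P : closedSet G) : set (closedSet G) :=
  [set cset_rmul (cset_inv P) a | a in P].

Definition order_compactification (P : closedSet G) : set (closedSet G) :=
  closure (translates P).

Lemma cset_rmul_continuous a : continuous (cset_rmul ^~ a).
Proof.
move=> A; apply/(@cvg_closedSetP _ (cset_rmul ^~ a @ nbhs A) _ _).
move=> H [[U oU <-]|[K cK <-]] HA.
- have /continuousP/(_ _ oU) oV := @mulgr_continuous a.
  have hitE B : hit U (cset_rmul B a) <-> hit ((fun x => x * a)%g @^-1` U) B.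
    split=> [[_ [[x Bx <-] Ux]]|[x [Bx Ux]]]; first by exists x.
    by exists (x * a)%g; split=> //; exists x.
  have : nbhs A (hit ((fun x => x * a)%g @^-1` U)).
    apply: open_nbhs_nbhs; split; last exact/hitE.
    by apply: vietoris_subbase_open; left; exists ((fun x => x * a)%g @^-1` U).
  by apply: filterS => B /hitE.
- pose L := [set (x * a^-1)%g | x in K].
  have cL : compact L.
    by apply: continuous_compact => //; apply/continuous_subspaceT/mulgr_continuous.
  have missE B : miss K (cset_rmul B a) <-> miss L B.
    rewrite /miss /=; split=> KL; apply/seteqP; split=> // x [Bx].
      case=> y Ky yx; rewrite -{}yx in Bx.
      suff : set0 y by []; rewrite -KL; split=> //.
      by exists (y * a^-1)%g => //; rewrite mulgVK.
    case: Bx => y By <- Kya; suff : set0 y by []; rewrite -KL; split=> //.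
    by exists (y * a)%g => //; rewrite mulgK.
  have : nbhs A (miss L).
    apply: open_nbhs_nbhs; split; last exact/missE.
    by apply: vietoris_subbase_open; right; exists L.
  by apply: filterS => B /missE.
Qed.

Lemma order_compactification_rmul (P A : closedSet G) a :
  (forall x y, cset P x -> cset P y -> cset P (x * y)%g) -> cset P a ->
  order_compactification P A -> order_compactification P (cset_rmul A a).
Proof.
move=> PM Pa PA V /cset_rmul_continuous /PA [_ [[b Pb <-] Vb]].
exists (cset_rmul (cset_rmul (cset_inv P) b) a); split=> //.
exists (b * a)%g; first exact: PM.
apply: closedSet_inj => /=; rewrite !rmul_setE; apply/funext => x /=.
by rewrite invgM mulgA.
Qed.

End group.

(* Regularity is not required: on a second countable locally compact group,
   a Borel measure that is finite on compact sets is regular. *)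
Record haarMeasure (R : realType) (G : lcscGroupType) := HaarMeasure {
  haar_measure :> {measure set (borel G) -> \bar R} ;
  haar_left_invariant : forall (g : G) (B : set (borel G)), measurable B ->
    haar_measure [set (g * x)%g | x in B] = haar_measure B ;
  haar_compact : forall K : set G, compact K -> (haar_measure K < +oo)%E ;
  haar_neq0 : haar_measure [set: G] != 0%E
}.

Section haar.
Context (R : realType) (G : lcscGroupType) (mu : haarMeasure R G).

Lemma continuous_borel (f : G -> G) : continuous f ->
  measurable_fun [set: borel G] (f : borel G -> borel G).
Proof.
move=> cf; apply: (@measurability _ _ (borel G) (borel G) setT f (@open G) erefl).
move=> _ [U oU <-]; rewrite setTI; apply: sub_sigma_algebra.
by move/continuousP: cf; exact.
Qed.

Lemma measurable_inv (E : set (borel G)) : measurable E ->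
  measurable ([set (x^-1)%g | x in E] : set (borel G)).
Proof.
move=> mE; rewrite inv_setE -[X in measurable X]setTI.
exact: (continuous_borel (@invg_continuous G)).
Qed.

Lemma measurable_lmul (E : set (borel G)) (g : G) : measurable E ->
  measurable ([set (g * x)%g | x in E] : set (borel G)).
Proof.
move=> mE; rewrite lmul_setE -[X in measurable X]setTI.
exact: (continuous_borel (@mulgl_continuous _ g^-1%g)).
Qed.

Lemma lcsc_basis_seq : exists2 b : nat -> set G, forall n, open (b n) &
  forall x U, nbhs x U -> exists2 n, b n x & b n `<=` U.
Proof.
have [B cB [oB bB]] := @lcsc_second_countable G.
move/pfcard_geP : cB => [B0|[f]].
  have [b []] := bB 1%g setT filterT; by rewrite B0.
exists f => [n|x U /bB [b [Bb bx] bU]]; first by apply: oB; exact: funS.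
by have [n _ fn] := @surj _ _ _ _ f _ Bb; exists n; rewrite fn.
Qed.

Lemma haar_sigma_finite : sigma_finite [set: borel G] mu.
Proof.
have [b ob bb] := lcsc_basis_seq.
exists (fun n => if (mu (b n) < +oo)%E then b n else set0) => [|n]; last first.
  case: ifPn => bn; last by rewrite measure0.
  by split=> //; apply: sub_sigma_algebra; exact: ob.
apply/seteqP; split=> // x _; have := @lcsc_locally_compact G x I.
rewrite withinET => -[K nK [cK clK]]; have [n bnx bnK] := bb _ _ nK.
exists n => //; rewrite ifT//; apply: (le_lt_trans _ (haar_compact mu cK)).
apply: le_measure => //; apply/mem_set.
  by apply: sub_sigma_algebra; exact: ob.
rewrite -[X in measurable X]setCK; apply: measurableC; apply: sub_sigma_algebra.
exact/closed_openC.
Qed.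

Lemma open_prod_measurable (W : set (G * G)) : open W ->
  measurable (W : set (borel G * borel G)%type).
Proof.
move=> oW; have [b ob bb] := lcsc_basis_seq.
pose F (nm : nat * nat) : set (borel G * borel G) :=
  if `[< b nm.1 `*` b nm.2 `<=` W >] then b nm.1 `*` b nm.2 else set0.
have -> : W = \bigcup_nm F nm.
  apply/seteqP; split=> [[x y] Wxy|[x y] [nm _]]; last first.
    by rewrite /F; case: asboolP => // sW xy; exact: sW.
  have [[U V] /= [nU nV] UVW] : nbhs (x, y) W by exact: open_nbhs_nbhs.
  have [n bnx bnU] := bb _ _ nU; have [m bmy bmV] := bb _ _ nV.
  exists (n, m) => //; rewrite /F; case: asboolP => //= -[].
  by move=> [u v] [/= /bnU Uu /bmV Vv]; exact: UVW.
apply: countable_bigcupT_measurable => // nm; rewrite /F; case: ifPn => // _.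
by apply: measurableX; apply: sub_sigma_algebra; exact: ob.
Qed.

(* an alias on which the sigma-finite structure can be declared *)
Let mu' : set (borel G) -> \bar R := mu.
HB.instance Definition _ := Measure.copy mu' (haar_measure mu).
HB.instance Definition _ :=
  @Measure_isSigmaFinite.Build _ _ R mu' haar_sigma_finite.
Let smu : {sigma_finite_measure set (borel G) -> \bar R} := mu'.

(* Apply Tonelli to [(x, y) |-> y^-1 x \in E]. *)
Lemma haar_null_inv (E : set (borel G)) : measurable E ->
  mu E = 0%E -> mu [set (x^-1)%g | x in E] = 0%E.
Proof.
move=> mE E0.
pose phi (z : borel G * borel G) : borel G := (z.2^-1 * z.1)%g.
have cphi : continuous (phi : G * G -> G).
  move=> z; apply: (@continuous_comp _ _ _ (fun z : G * G => (z.2^-1, z.1)%g)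
    (fun x : G * G => (x.1 * x.2)%g)); last exact: mulg_continuous.
  apply: cvg_pair; last exact: cvg_fst.
  by apply: continuous_comp; [exact: cvg_snd|exact: invg_continuous].
have mphi : measurable_fun setT phi.
  apply: (@measurability _ _ _ (borel G) setT phi (@open G) erefl).
  move=> _ [U oU <-]; rewrite setTI; apply: open_prod_measurable.
  by move/continuousP : cphi; exact.
have mA : measurable (phi @^-1` E) by rewrite -[X in measurable X]setTI; exact: mphi.
have := indic_fubini_tonelli smu smu mA.
rewrite (indic_fubini_tonelli_FE smu mA) (indic_fubini_tonelli_GE smu mA).
have -> : smu \o ysection (phi @^-1` E) = cst 0%E.
  apply/funext => y /=; rewrite ysectionE.
  have -> : (fun x => (x, y)) @^-1` (phi @^-1` E) = [set (y * x)%g | x in E].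
    by rewrite lmul_setE.
  by rewrite [LHS]haar_left_invariant.
have -> : smu \o xsection (phi @^-1` E) = cst (mu [set (x^-1)%g | x in E]).
  apply/funext => x /=; rewrite xsectionE.
  have -> : (fun y => (x, y)) @^-1` (phi @^-1` E) =
      [set (x * y)%g | y in [set (x^-1)%g | x in E]].
    by rewrite lmul_setE inv_setE; apply/funext => y; rewrite /phi/= invgM invgK.
  by rewrite [LHS]haar_left_invariant//; exact: measurable_inv.
rewrite integral0 integral_cst//.
by move/eqP; rewrite mule_eq0 (negPf (haar_neq0 mu)) orbF => /eqP.
Qed.

Lemma haar_null_rmul (E : set (borel G)) (a : G) : measurable E ->
  mu E = 0%E -> mu [set (x * a)%g | x in E] = 0%E.
Proof.
move=> mE E0; have mE' := measurable_inv mE.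
have : mu [set (a^-1 * x)%g | x in [set (x^-1)%g | x in E]] = 0%E.
  by rewrite haar_left_invariant// haar_null_inv.
move=> /(haar_null_inv (measurable_lmul _ mE')) <-.
congr (mu _); apply/seteqP; split=> [_ [x Ex <-]|].
  exists (a^-1 * x^-1)%g; last by rewrite invgM !invgK.
  by exists (x^-1)%g => //; exists x.
by move=> _ [_ [_ [x Ex <-] <-] <-]; exists x => //; rewrite invgM !invgK.
Qed.

Lemma ae_rmul (Q : set (borel G)) (a : G) : (\forall x \ae mu, Q x) ->
  \forall x \ae mu, Q (x * a^-1)%g.
Proof.
move=> [N [mN N0 QN]]; exists [set (x * a)%g | x in N]; split.
- rewrite rmul_setE -[X in measurable X]setTI.
  by apply: continuous_borel => //; exact: mulgr_continuous.
- exact: haar_null_rmul.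
- by rewrite rmul_setE => x /= nQx; apply: QN.
Qed.

Section translation.
Variable a : G.

Let rho (x : borel G) : borel G := (x * a^-1)%g.
Let mrho : measurable_fun setT rho.
Proof. exact: (continuous_borel (@mulgr_continuous _ a^-1%g)). Qed.
HB.instance Definition _ := isMeasurableFun.Build _ _ _ _ rho mrho.

Definition rtranslate_fun (f : {mfun borel G >-> measurableTypeR R}) :
  {mfun borel G >-> measurableTypeR R} := [the {mfun _ >-> _} of f \o rho].

Lemma rtranslate_finite_norm (f : {mfun borel G >-> measurableTypeR R}) :
  finite_norm mu +oo (f : _ -> R) ->
  finite_norm mu +oo (rtranslate_fun f : _ -> R).
Proof.
rewrite /finite_norm unlock; case: ifPn => // _; apply: le_lt_trans.
apply/ess_supP.
set s := ess_sup _ _.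
exact: (@ae_rmul (fun x => (abse \o (EFin \o f)) x <= s)%E a (ess_sup_ge _ _)).
Qed.

(* The class of [x |-> f (x * a^-1)]; it does not depend on the representative
   of [f], see [rtranslate_classE]. *)
Definition rtranslate (f : Linf mu) : Linf mu :=
  Linf_class (rtranslate_finite_norm (Linf_finite_norm f)).

Lemma rtranslate_classE (f : {mfun borel G >-> measurableTypeR R}) ff :
  ae_eq mu setT (rtranslate (@Linf_class _ _ _ mu f ff) : _ -> R)
    (fun x => f (x * a^-1)%g).
Proof.
apply: ae_eq_trans (Linf_classE _) _; rewrite /= /rtranslate_fun /=.
have h : \forall x \ae mu, [set x | (Linf_class ff : _ -> R) x = f x] x.
  by have := Linf_classE ff; apply: filterS => x /= /(_ I).
have [N [mN N0 hN]] := ae_rmul a h; exists N; split=> // x /= nx.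
by apply: hN => /= hx; apply: nx.
Qed.

End translation.

Lemma indic_finite_norm (A : set (borel G)) : finite_norm mu +oo (\1_A : _ -> R).
Proof.
rewrite /finite_norm unlock; case: ifPn => // _.
apply: (@le_lt_trans _ _ 1%E) => //; last exact: ltry.
by apply/ess_supP/aeW => x /=; rewrite lee_fin ger0_norm.
Qed.

Lemma closed_borel (A : closedSet G) : measurable (A : set (borel G)).
Proof.
rewrite -[X in measurable X]setCK; apply: measurableC; apply: sub_sigma_algebra.
exact/closed_openC/cset_closed.
Qed.

Definition closed_indic (A : closedSet G) : borel G -> measurableTypeR R := \1_A.

Lemma closed_indic_measurable A : measurable_fun setT (closed_indic A).
Proof. exact: (@measurable_indic _ (borel G) R setT A (closed_borel A)). Qed.

HB.instance Definition _ A := isMeasurableFun.Build _ _ _ _ (closed_indic A)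
  (closed_indic_measurable A).

Definition indic_Linf (A : closedSet G) : Linf mu :=
  @Linf_class _ _ _ mu (closed_indic A) (indic_finite_norm A).

End haar.

Definition support (T : topologicalType) (R : realType) (nu : set T -> \bar R) :
  set T := [set x | forall U, open U -> U x -> (0 < nu U)%E].

Definition solid (R : realType) (G : lcscGroupType) (mu : haarMeasure R G)
    (A : set G) :=
  A `<=` closure A° /\ support (fun B : set G => mu (B `&` A)) = A.

Definition condition_M (R : realType) (G : lcscGroupType)
    (mu : haarMeasure R G) (P : closedSet G) :=
  forall f : Linf_weakstar mu,
    closure [set (indic_Linf mu B : Linf_weakstar mu) | B in translates P] f ->
    exists2 A : closedSet G, solid mu A & f = indic_Linf mu A.

(* The restriction of [f] to [X] is a homeomorphism onto its image. *)
Definition topological_embedding (S T : topologicalType) (X : set S)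
    (f : S -> T) :=
  [/\ {within X, continuous f}, {in X &, injective f} &
      forall U, open U -> exists2 V, open V & f @` (X `&` U) = f @` X `&` V].

(* Main.v *)
(* Every [A] in the order compactification is closed and satisfies
   [P^-1 A `<=` A].  Since [1] is a limit of points [s] of the interior of
   [P^-1], and [s A `<=` A°] for such [s], the interior of [A] is dense in [A],
   and the boundary of [A] is null: its translates by [s] are disjoint from it
   and converge to it.  If [A_n --> A] in the order compactification then
   [1_(A_n) --> 1_A] off the boundary of [A], hence almost everywhere, so
   [A |-> 1_A] is weak* continuous by dominated convergence.  It is injective
   because [A] is the closure of its interior and nonempty open sets have
   positive measure.  The order compactification being compact and the weak*
   topology Hausdorff, the map is an embedding with closed image. *)
From HB Require Import structures.
From mathcomp Require Import all_boot all_order all_algebra.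
From mathcomp Require Import all_classical all_reals all_analysis.
From mathcomp Require Import ess_sup_inf measurable_realfun.
Require Import Defs.
Set Implicit Arguments.
Unset Strict Implicit.
Unset Printing Implicit Defensive.
Import Order.TTheory GRing.Theory Num.Theory.
Import numFieldNormedType.Exports.
Local Open Scope classical_set_scope.
Local Open Scope ring_scope.

(** * Compactness of the space of closed sets *)

(** An ultrafilter [F] converges to the set of points all of whose open neighborhoods are hit by
    [F]-almost every set. Any other point has an open neighborhood that [F]-almost every set misses,
    and finitely many of these cover a compact [K] disjoint from the limit. *)
Lemma closedSet_compact (T : topologicalType) : compact [set: closedSet T].
Proof.
rewrite compact_ultra => F FU _.
pose A := [set x : T | forall U, open U -> U x -> F (hit U)].
have cA : closed A.
  move=> x clAx U oU Ux.
  have [y [Ay Uy]] := clAx U (open_nbhs_nbhs (conj oU Ux)).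
  exact: Ay.
exists (ClosedSet cA); split=> //.
apply/cvg_closedSetP => _ [[U oU <-] [x [Ax Ux]]|[K cK <-] AK]; first exact: Ax.
have : \forall B \near F, K `<=` (fun x => ~ cset B x).
  have /compact_near_coveringP := cK; apply => x Kx.
  have nAx : ~ A x by move=> Ax; have : set0 x by rewrite -AK.
  have [U [oU Ux nF]] : exists U, [/\ open U, U x & ~ F (hit U)].
    apply: contrapT => h; apply: nAx => U oU Ux; apply: contrapT => nF.
    by apply: h; exists U.
  have FU' : F (~` hit U) by case: (in_ultra_setVsetC (hit U) FU).
  exists (U, ~` hit U); first by split=> //=; exact: open_nbhs_nbhs.
  by move=> [y B] [/= Uy nB] By; apply: nB; exists y.
apply: filterS => B KB; apply/seteqP; split=> // y [By Ky].
exact: KB Ky By.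
Qed.

(** * Sets stable under left multiplication by inverses of elements of [P] *)

Section saturated.
Context (G : lcscGroupType) (P : closedSet G).
Implicit Types (A B : closedSet G) (x y p : G).

Lemma divg_continuous : continuous (fun z : G * G => (z.1 * z.2^-1)%g).
Proof.
move=> z; apply: (@continuous_comp _ _ _ (fun z : G * G => (z.1, z.2^-1)%g)
  (fun x : G * G => (x.1 * x.2)%g)); last exact: mulg_continuous.
apply: cvg_pair; first exact: cvg_fst.
by apply: continuous_comp; [exact: cvg_snd|exact: invg_continuous].
Qed.

Lemma nbhs_compact x (U : set G) : nbhs x U ->
  exists K : set G, [/\ nbhs x K, compact K & K `<=` U].
Proof.
move=> nU; have := @lcsc_locally_compact G x I.
rewrite withinET => -[L nL [cL clL]].
have [B nB BU] := compact_regular (@lcsc_hausdorff G) cL nL (filterI nU nL).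
exists (closure B); split; last by move=> y /BU[].
  exact: filterS (@subset_closure _ _) nB.
by apply: (subclosed_compact _ cL); [exact: closed_closure|move=> y /BU[]].
Qed.

Definition saturated (A : set G) :=
  forall p x, cset P p -> A x -> A (p^-1 * x)%g.

(** Each [P^-1 a] is saturated because [P] is a semigroup. A failure of saturation at [p] and [x]
    would pass to sets near [A]: they hit a neighborhood of [x] that [p^-1] carries into a compact
    set which they miss. *)
Lemma order_compactification_saturated A :
  (forall x y, cset P x -> cset P y -> cset P (x * y)%g) ->
  order_compactification P A -> saturated A.
Proof.
move=> PM XA p x Pp Ax; apply: contrapT => nApx.
have nAC : nbhs (p^-1 * x)%g (~` A).
  by apply: open_nbhs_nbhs; split=> //; exact/closed_openC/cset_closed.
have [K [nK cK KA]] := nbhs_compact nAC.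
pose U := [set y : G | K (p^-1 * y)%g].
have nU : nbhs x U by exact: (@mulgl_continuous _ p^-1%g x _ nK).
have : nbhs A (hit U° `&` miss K).
  apply: filterI; apply: open_nbhs_nbhs; split.
  - apply: vietoris_subbase_open; left; exists U° => //.
    exact: open_interior.
  - by exists x.
  - by apply: vietoris_subbase_open; right; exists K.
  - by apply/seteqP; split=> // y [Ay /KA].
move=> /XA[_ [[a Pa <-] [[y [Ay /interior_subset Uy]] KB]]].
suff : set0 (p^-1 * y)%g by [].
rewrite -KB; split=> //; case: Ay => z [q Pq <-] <-.
exists (p^-1 * q^-1)%g; last by rewrite mulgA.
by exists (q * p)%g; [exact: PM|rewrite invgM].
Qed.

Hypothesis P1 : cset P 1%g.
Hypothesis Pint : cset P `<=` closure (cset P)°.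

Lemma interior_near1 (V : set G) : nbhs 1%g V -> exists2 p, (cset P)° p & V p.
Proof. by move=> /(Pint P1)[p []]; exists p. Qed.

(** A point [z] near [p^-1 x] equals [q^-1 x] with [q = x z^-1] near [p], hence in [P]. *)
Lemma saturated_interior (A : set G) p x : saturated A ->
  (cset P)° p -> A x -> A° (p^-1 * x)%g.
Proof.
move=> sA Pp Ax; have : nbhs (p^-1 * x)%g [set z | cset P (x * z^-1)%g].
  apply: (@continuous_comp _ _ _
    (fun z : G => (x, z)) (fun z => z.1 * z.2^-1)%g).
  - by apply: cvg_pair => //; exact: cvg_cst.
  - exact: divg_continuous.
  - by rewrite /= invgM invgK mulVKg.
by apply: filterS => z /= Pz; have := sA _ _ Pz Ax; rewrite invgM invgK mulgVK.
Qed.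

(** The points [p^-1 x] with [p] in the interior of [P] lie in the interior of [A], and they
    approach [x] as [p] approaches 1. *)
Lemma saturated_regular (A : set G) : saturated A -> A `<=` closure A°.
Proof.
move=> sA x Ax V nV.
have [p Pp Vp] : exists2 p, (cset P)° p & V (p^-1 * x)%g.
  apply: interior_near1.
  apply: (@continuous_comp _ _ _ (fun z : G => (z^-1)%g) (fun z => z * x)%g).
  - exact: invg_continuous.
  - exact: mulgr_continuous.
  - by rewrite /= invg1 mul1g.
by exists (p^-1 * x)%g; split=> //; exact: saturated_interior.
Qed.

(* If [x] is interior to [A] then [x = p^-1 y] for some [y] in [A] and [p] in
   the interior of [P]; every saturated set meeting a small neighborhood of [y]
   contains a neighborhood of [x]. *)
Lemma saturated_near_eq A x : saturated A -> ~ (cset A `\` (cset A)°) x ->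
  exists W : set G, nbhs x W /\
    \forall B \near A, saturated (cset B) ->
      cset B `&` W = cset A `&` W.
Proof.
move=> sA nbx; have [Aix|nAix] := pselect ((cset A)° x); last first.
  have nAx : ~ cset A x by move=> Ax; apply: nbx.
  have nAC : nbhs x (~` A).
    by apply: open_nbhs_nbhs; split=> //; exact/closed_openC/cset_closed.
  have [K [nK cK KA]] := nbhs_compact nAC; exists K; split=> //.
  have AK : miss K A by apply/seteqP; split=> // y [Ay /KA].
  have : nbhs A (miss K).
    apply: open_nbhs_nbhs; split=> //.
    by apply: vietoris_subbase_open; right; exists K.
  by apply: filterS => B KB _; rewrite [LHS]KB [RHS]AK.
have [p Pp Apx] : exists2 p, (cset P)° p & cset A (p * x)%g.
  apply: interior_near1; apply: mulgr_continuous; rewrite mul1g; exact: Aix.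
have nP : nbhs ((p * x)%g, x) [set z : G * G | cset P (z.1 * z.2^-1)%g].
  by apply: divg_continuous; rewrite /= mulgK; exact: Pp.
have [[U W] /= [nU nW] UW] := nP; exists (A `&` W); split; first exact: filterI.
have : nbhs A (hit U°).
  apply: open_nbhs_nbhs; split; last by exists (p * x)%g.
  by apply: vietoris_subbase_open; left; exists U° => //; exact: open_interior.
apply: filterS => B [u [Bu /interior_subset Uu]] sB.
rewrite [RHS]setIA setIid; apply/seteqP; split=> [z []|z [Az Wz]] //.
split=> //; have /= Puz := UW (u, z) (conj Uu Wz).
by have := sB _ _ Puz Bu; rewrite invgM invgK mulgVK.
Qed.

End saturated.

(** * Null sets and open sets for Haar measure *)

Section haar_null.
Context (R : realType) (G : lcscGroupType) (mu : haarMeasure R G).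

Lemma open_borel (U : set G) : open U -> measurable (U : set (borel G)).
Proof. exact: sub_sigma_algebra. Qed.

Lemma compact_borel (K : set G) : compact K -> measurable (K : set (borel G)).
Proof.
move=> /(compact_closed (@lcsc_hausdorff G)) cK.
exact: (closed_borel (ClosedSet cK)).
Qed.

(** By second countability, [D] is covered by countably many basic open sets whose intersections
    with [D] are negligible. *)
Lemma negligible_nbhs (D : set (borel G)) :
  (forall x : G, exists2 W : set G, nbhs x W & mu.-negligible (D `&` W)) ->
  mu.-negligible D.
Proof.
move=> hD; have [b ob bb] := @lcsc_basis_seq G.
pose F n := if `[< mu.-negligible (D `&` b n) >] then D `&` b n else set0.
apply: (@negligibleS _ _ _ _ (\bigcup_n F n)) => [x Dx|].
  have [W nW DW] := hD x; have [n bx bW] := bb _ _ nW.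
  exists n => //; rewrite /F asboolT//.
  by apply: negligibleS DW; exact: setIS.
apply: negligible_bigcup => n; rewrite /F; case: asboolP => // _.
exact: negligible_set0.
Qed.

(** If [U] were null, its left translates would give every point a null neighborhood, so the whole
    group would be null. *)
Lemma haar_open_gt0 (U : set G) : open U -> U !=set0 -> (0 < mu U)%E.
Proof.
move=> oU [u Uu]; rewrite lt0e measure_ge0 andbT; apply/eqP => U0.
have /negP := haar_neq0 mu; apply; apply/eqP.
apply/negligibleP; first exact: measurableT.
apply: negligible_nbhs => x; exists [set (x * u^-1 * z)%g | z in U].
  rewrite lmul_setE; apply: open_nbhs_nbhs; split.
    by move/continuousP: (@mulgl_continuous G (x * u^-1)^-1%g); exact.
  by rewrite /= -{2}(mulgVK u x) mulKg.
rewrite setTI; apply/negligibleP.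
  by apply: measurable_lmul; exact: open_borel.
by rewrite [LHS]haar_left_invariant//; exact: open_borel.
Qed.

End haar_null.

(** * The boundary of a closed saturated set is null *)

Section boundary.
Context (R : realType) (G : lcscGroupType) (mu : haarMeasure R G).
Context (P : closedSet G).
Hypothesis P1 : cset P 1%g.
Hypothesis Pint : cset P `<=` closure (cset P)°.

Lemma interior_seq (V : set G) : nbhs 1%g V ->
  exists p : nat -> G, [/\ forall n, (cset P)° (p n), forall n, V (p n) &
    p @ \oo --> (1%g : G)].
Proof.
move=> nV; have [b ob bb] := @lcsc_basis_seq G.
(* Basic sets not containing 1 are replaced by the whole group, so [c 0], ..., [c n] intersect in a
   neighborhood of 1, from which [p n] is chosen. *)
pose c n := if `[< b n 1%g >] then b n else setT.
have nc n : nbhs 1%g [set y : G | forall i, (i <= n)%N -> c i y].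
  have nci i : nbhs (1%g : G) (c i).
    rewrite /c; case: asboolP => [b1|_]; last exact: filterT.
    exact: open_nbhs_nbhs.
  elim: n => [|n IHn].
    by apply: filterS (nci 0%N) => y cy i; rewrite leqn0 => /eqP ->.
  apply: filterS (filterI IHn (nci n.+1)) => y [hy cy] i.
  by rewrite leq_eqVlt => /predU1P[->//|]; rewrite ltnS => /hy.
have /choice[p hp] n : exists y, (cset P)° y /\
    (V y /\ forall i, (i <= n)%N -> c i y).
  have [y Py [Vy cy]] := interior_near1 P1 Pint (filterI nV (nc n)).
  by exists y.
exists p; split=> [n|n|]; first by case: (hp n).
  by case: (hp n) => _ [].
move=> U /bb[m b1 bU]; exists m => // n /= mn.
by apply: bU; have [_ [_ /(_ _ mn)]] := hp n; rewrite /c asboolT.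
Qed.

(* With [p n] in the interior of [P] tending to [1], the sets [(p n)^-1 K] are
   disjoint from [K] and have the measure of [K], while their limsup is
   contained in [K], hence empty. *)
Lemma compact_boundary_null (A : set G) (K : set G) : saturated P A ->
  compact K -> K `<=` A `\` A° -> mu K = 0%E.
Proof.
move=> sA cK KA.
have [L [nL cL _]] := nbhs_compact (@filterT _ (nbhs (1%g : G)) _).
have nV : nbhs (1%g : G) [set y | L (y^-1)%g].
  by apply: (@invg_continuous G 1%g); rewrite invg1.
have [p [Pp Lp p1]] := interior_seq nV.
pose E n : set (borel G) := [set ((p n)^-1 * x)%g | x in K].
have mK : measurable (K : set (borel G)) by exact: compact_borel.
have mE n : measurable (E n) by exact: measurable_lmul.
have muE n : mu (E n) = mu K by rewrite [LHS]haar_left_invariant.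
(* All the [E n] lie in the compact set [M], which gives the finite measure needed for continuity
   along [lim_sup_set]. *)
pose M : set G := (fun z : G * G => (z.1 * z.2)%g) @` (L `*` K).
have cM : compact M.
  apply: continuous_compact; last exact: compact_setX.
  by apply: continuous_subspaceT; exact: mulg_continuous.
have EM : \bigcup_(k >= 0) E k `<=` M.
  move=> _ [n _ [x Kx <-]]; exists ((p n)^-1, x)%g => //; split=> //; exact: Lp.
have limE : lim_sup_set E = set0.
  apply/seteqP; split=> // x Ex.
  have EP n : E n x <-> K (p n * x)%g by rewrite /E lmul_setE /= invgK.
  have [Kx|nKx] := pselect (K x).
    have [n _ [k Kk kx]] := Ex 0%N I.
    have [_ []] := KA _ Kx; rewrite -kx; apply: (saturated_interior sA) => //.
    by have [] := KA _ Kk.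
  have nKC : nbhs x (~` K).
    apply: open_nbhs_nbhs; split=> //; apply: closed_openC.
    by apply: compact_closed => //; exact: lcsc_hausdorff.
  have : \forall n \near \oo, (~` K) (p n * x)%g.
    apply: (p1 [set y | (~` K) (y * x)%g]).
    by apply: (@mulgr_continuous G x 1%g (~` K)); rewrite mul1g.
  by move=> [n _ hn]; have [m nm /EP] := Ex n I; exact: hn.
have : mu (\bigcup_(k >= n) E k) @[n --> \oo] --> 0%E.
  rewrite -(measure0 mu) -limE; apply: lim_sup_set_cvg => //.
  apply: le_lt_trans (haar_compact mu cM); apply: le_measure => //.
    by apply/mem_set; exact: bigcup_measurable.
  by apply/mem_set; exact: compact_borel.
(* Each tail union contains some [E n], so its measure is at least [mu K]; hence so is the limit
   0. *)
move=> h; apply/eqP; rewrite eq_le measure_ge0 andbT -(cvg_lim _ h)//.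
apply: lime_ge; first by apply/cvg_ex; exists 0%E.
apply: nearW => n; rewrite -(muE n); apply: le_measure.
- exact/mem_set.
- by apply/mem_set; exact: bigcup_measurable.
- by apply: bigcup_sup => /=.
Qed.

(** The boundary is closed, so its trace on a compact neighborhood is compact; local negligibility
    then suffices. *)
Lemma saturated_boundary_null (A : closedSet G) : saturated P A ->
  mu.-negligible (cset A `\` (cset A)°).
Proof.
move=> sA; apply: negligible_nbhs => x.
have [K [nK cK _]] := nbhs_compact (@filterT _ (nbhs (x : G)) _).
exists K => //.
have cKD : compact ((cset A `\` (cset A)°) `&` K).
  apply: (subclosed_compact _ cK); last exact: subIsetr.
  apply: closedI; last by apply: compact_closed => //; exact: lcsc_hausdorff.
  by apply: closedI; [exact: cset_closed|exact/open_closedC/open_interior].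
apply/negligibleP; first exact: compact_borel.
exact: compact_boundary_null sA cKD (@subIsetl _ _ _).
Qed.

End boundary.

(** * The pairing of bounded and integrable functions *)

Section duality.
Context d (T : measurableType d) (R : realType).
Variable mu : {measure set T -> \bar R}.

Lemma Linf_measurable (f : Linf mu) : measurable_fun setT (f : T -> R).
Proof. exact: (measurable_funPT (repr (LebesgueSpace.sort f))). Qed.

Lemma L1_measurable (f : L1 mu) : measurable_fun setT (f : T -> R).
Proof. exact: (measurable_funPT (repr (LebesgueSpace.sort f))). Qed.

Lemma L1_integrable (g : L1 mu) : mu.-integrable setT (EFin \o (g : T -> R)).
Proof.
apply/Lfun1_integrable; apply/andP; split; rewrite inE /=.
  exact: L1_measurable.
by case: g => g [[]].
Qed.

Lemma Linf_bounded (f : Linf mu) :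
  exists M : R, \forall x \ae mu, `|(f : T -> R) x| <= M.
Proof.
have := Linf_finite_norm f; rewrite /finite_norm unlock; case: ifPn => [_|].
  by move=> /ess_supr_bounded.
(* The norm at [+oo] is an essential supremum only on a space of positive measure; here the whole
   space serves as the exceptional null set. *)
rewrite -leNgt => mu0 _; exists 0; exists setT; split=> //.
by apply/le_anti/andP; split=> //; exact: measure_ge0.
Qed.

Lemma ae_eq_Rintegral (D : set T) (f g : T -> R) : measurable D ->
  measurable_fun D f -> measurable_fun D g -> ae_eq mu D f g ->
  \int[mu]_(x in D) f x = \int[mu]_(x in D) g x.
Proof.
move=> mD mf mg fg; congr fine; apply: ae_eq_integral => //.
- exact/measurable_EFinP.
- exact/measurable_EFinP.
- by apply: filterS fg => x /= h Dx; rewrite h.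
Qed.

Lemma pairingE (f : Linf mu) (g : L1 mu) (f' g' : T -> R) :
  measurable_fun setT f' -> measurable_fun setT g' ->
  ae_eq mu setT (f : T -> R) f' -> ae_eq mu setT (g : T -> R) g' ->
  pairing f g = \int[mu]_x (f' x * g' x).
Proof.
move=> mf' mg' ff' gg'; apply: ae_eq_Rintegral => //.
- by apply: measurable_funM; [exact: Linf_measurable|exact: L1_measurable].
- exact: measurable_funM.
- by apply: filterS2 ff' gg' => x fx gx xT; rewrite fx// gx.
Qed.

Lemma L1_class (f : T -> R) : mu.-integrable setT (EFin \o f) ->
  exists g : L1 mu, ae_eq mu setT (g : T -> R) f.
Proof.
move=> fi; have mf : measurable_fun setT f.
  by apply/measurable_EFinP; exact: measurable_int fi.
pose F : {mfun T >-> measurableTypeR R} :=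
  HB.pack f (isMeasurableFun.Build _ _ T (measurableTypeR R) f mf).
pose cls : {mfun_ mu, T >-> measurableTypeR R} :=
  (\pi_({mfun_ mu, T >-> measurableTypeR R}) F)%qT.
have clsf : ae_eq mu setT (cls : T -> R) f by exact: repr_class_ae.
have mcls : measurable_fun setT (cls : T -> R).
  exact: (measurable_funPT (repr cls)).
have cls_fin : finite_norm mu 1 cls.
  suff : (cls : T -> R) \in Lfun mu 1 by case/andP => _; rewrite inE.
  apply/Lfun1_integrable/integrableP; split; first exact/measurable_EFinP.
  have /integrableP[_] := fi; congr (_ < _)%E; apply: ae_eq_integral => //.
  - by apply/measurableT_comp => //; exact/measurable_EFinP.
  - by apply/measurableT_comp => //; exact/measurable_EFinP.
  - by apply: filterS clsf => x /= h xT; rewrite h.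
pose g : LspaceType mu (@lexx _ _ 1%E) :=
  HB.pack cls (isFinLebesgue.Build d T R mu 1%E (lexx _) cls cls_fin).
by exists g.
Qed.

Lemma Linf_integrable (D : set T) (f : Linf mu) : measurable D ->
  (mu D < +oo)%E -> mu.-integrable D (EFin \o (f : T -> R)).
Proof.
move=> mD Doo; have [M fM] := Linf_bounded f.
have mf : measurable_fun D (EFin \o (f : T -> R)).
  by apply/measurable_EFinP; apply: measurable_funTS; exact: Linf_measurable.
apply/integrableP; split=> //.
apply: (@le_lt_trans _ _ (\int[mu]_(x in D) `|M|%:E)%E).
  apply: ae_ge0_le_integral => //; first exact: measurableT_comp.
  apply: filterS fM => x fxM _ /=; rewrite lee_fin.
  by rewrite (le_trans fxM)// ler_norm.
by rewrite integral_cst// lte_mul_pinfty.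
Qed.

Lemma pairing_indic (E : set T) : measurable E -> (mu E < +oo)%E ->
  exists g : L1 mu, forall f : Linf mu,
    pairing f g = \int[mu]_(x in E) (f : T -> R) x.
Proof.
move=> mE Eoo.
have Ei : mu.-integrable setT (EFin \o (\1_E : T -> R)).
  apply/integrableP; split; first exact/measurable_EFinP/measurable_indic.
  under eq_integral do rewrite /= ger0_norm//.
  by rewrite integral_indic// setIT.
have [g gE] := L1_class Ei.
exists g => f; rewrite (pairingE (Linf_measurable f) _ (ae_eq_refl _ _ _) gE);
  last exact: measurable_indic.
by rewrite [RHS]Rintegral_mkcond patch_indic.
Qed.

(** Testing against indicators of sets of finite measure shows that both functions have equal
    integrals over every measurable part of each [F n], so they agree almost everywhere there. *)
Lemma pairing_inj : sigma_finite setT mu -> injective (@pairing _ _ _ mu).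
Proof.
move=> [F TF mF] f h fh; apply/Linf_eqP.
have fhF n : ae_eq mu (F n) (f : T -> R) h.
  have [mFn Fnoo] := mF n.
  have : ae_eq mu (F n) (EFin \o (f : T -> R)) (EFin \o (h : T -> R)).
    apply: integral_ae_eq => //; first exact: Linf_integrable.
      apply/measurable_EFinP; apply: measurable_funTS.
      exact: Linf_measurable.
    move=> E EF mE; have Eoo : (mu E < +oo)%E.
      by rewrite (le_lt_trans _ Fnoo)// le_measure ?inE//.
    have [g gE] := pairing_indic mE Eoo.
    rewrite -[LHS]fineK; last exact/integrable_fin_num/Linf_integrable.
    rewrite -[RHS]fineK; last exact/integrable_fin_num/Linf_integrable.
    by congr EFin; have := gE f; rewrite fh gE.
  by apply: filterS => x /= fhx Fx; have [] := fhx Fx.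
have : \forall x \ae mu, forall n, F n x -> (f : T -> R) x = (h : T -> R) x.
  exact: ae_foralln.
apply: filterS => x fhx _; have [n _ Fnx] : (\bigcup_n F n) x by rewrite -TF.
exact: fhx Fnx.
Qed.

Lemma integrable_indicM (A : set T) (g : T -> R) : measurable A ->
  mu.-integrable setT (EFin \o g) ->
  mu.-integrable setT (EFin \o (fun x => \1_A x * g x)).
Proof.
move=> mA gi; have mg : measurable_fun setT g.
  by apply/measurable_EFinP; exact: measurable_int gi.
apply: (le_integrable measurableT _ _ gi) => [|x _ /=].
  by apply/measurable_EFinP; apply: measurable_funM.
by rewrite lee_fin normrM indicE normr_nat ler_piMl// lern1 leq_b1.
Qed.

(** The difference of the two indicators is at most 1 in absolute value and vanishes off [D]. *)
Lemma Rintegral_indicB_le (A B D : set T) (g : T -> R) :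
  measurable A -> measurable B -> measurable D -> A `\` D = B `\` D ->
  mu.-integrable setT (EFin \o g) ->
  `|\int[mu]_x (\1_A x * g x) - \int[mu]_x (\1_B x * g x)| <=
    \int[mu]_(x in D) `|g x|.
Proof.
move=> mA mB mD ABD gi.
have gAi := integrable_indicM mA gi; have gBi := integrable_indicM mB gi.
rewrite -RintegralB//; apply: le_trans.
  apply: le_normr_Rintegral => //.
  by have := integrableB measurableT gAi gBi; under eq_fun do rewrite -EFinB.
rewrite [leRHS]Rintegral_mkcond; apply: le_Rintegral => //.
- have := integrable_abse (integrableB measurableT gAi gBi).
  by congr (mu.-integrable _ _); apply/funext => x.
- have := integrable_abse (integrable_indicM mD gi).
  congr (mu.-integrable _ _); apply/funext => x /=.
  by rewrite patch_indic /= normrM indicE normr_nat mulrC.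
- move=> x _; rewrite -mulrBl normrM patch_indic /= mulrC.
  apply: ler_wpM2l => //; rewrite !indicE.
  have [xD|xD] := boolP (x \in D).
    by case: (_ \in A); case: (_ \in B);
      rewrite ?subrr ?subr0 ?sub0r ?normrN ?normr0 ?normr1.
  have -> : (x \in A) = (x \in B).
    apply/idP/idP => /set_mem xAB; apply/mem_set.
      have : (A `\` D) x by split=> //; rewrite notin_setE in xD.
      by rewrite ABD => -[].
    have : (B `\` D) x by split=> //; rewrite notin_setE in xD.
    by rewrite -ABD => -[].
  by rewrite subrr normr0.
Qed.

(** Dominated convergence, with [|g|] dominating its restrictions to the sets [D_ n]. *)
Lemma Rintegral_vanishing (D_ : (set T)^nat) (g : T -> R) :
  (forall n, measurable (D_ n)) ->
  {ae mu, forall x, \forall n \near \oo, ~ D_ n x} ->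
  mu.-integrable setT (EFin \o g) ->
  \int[mu]_(x in D_ n) `|g x| @[n --> \oo] --> (0 : R).
Proof.
move=> mD D0 gi.
pose f_ n x : \bar R := ((\1_(D_ n) x * `|g x|)%:E).
have mg : measurable_fun setT g.
  by apply/measurable_EFinP; exact: measurable_int gi.
have mgn : measurable_fun setT (fun x => `|g x|) by exact: measurableT_comp.
have mf_ n : measurable_fun setT (f_ n).
  by apply/measurable_EFinP; apply: measurable_funM.
have f_0 : {ae mu, forall x, setT x -> f_ ^~ x @ \oo --> (0 : \bar R)%E}.
  apply: filterS D0 => x Dx _; apply: cvg_near_cst; apply: filterS Dx => n nDx.
  by rewrite /f_ indicE memNset// mul0r.
have gni : mu.-integrable setT (fun x => (`|g x|)%:E).
  by have := integrable_abse gi; congr (mu.-integrable _ _).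
have f_g : {ae mu, forall x n, setT x -> (`|f_ n x| <= (`|g x|)%:E)%E}.
  apply: aeW => x n _; rewrite /f_ lee_fin normrM normr_id indicE normr_nat.
  by rewrite ler_piMl// lern1 leq_b1.
have [_ _] :=
  dominated_convergence measurableT mf_ (measurable_cst 0%E) f_0 gni f_g.
rewrite integral0 => /fine_cvg; apply: cvg_trans.
apply: near_eq_cvg; apply: nearW => n /=.
rewrite Rintegral_mkcond patch_indic; congr fine; apply: eq_integral => x _.
by rewrite /f_ /= mulrC.
Qed.

End duality.

(** * Continuity, injectivity and solidity on the order compactification *)

Section embedding.
Context (R : realType) (G : lcscGroupType) (mu : haarMeasure R G).
Context (P : closedSet G).
Hypothesis P1 : cset P 1%g.
Hypothesis Pint : cset P `<=` closure (cset P)°.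

(* Off the null boundary of [A], the membership of a point in saturated sets
   close to [A] is locally constant, so countably many basic open sets decide
   membership almost everywhere. *)
Lemma Rintegral_indic_cvg (A : closedSet G) (g : borel G -> R) :
  saturated P (cset A) -> mu.-integrable setT (EFin \o g) ->
  forall e : R, 0 < e -> \forall B \near A, saturated P (cset B) ->
    `|\int[mu]_x (\1_(cset A) x * g x) - \int[mu]_x (\1_(cset B) x * g x)| < e.
Proof.
move=> sA gi e e0; have [b ob bb] := @lcsc_basis_seq G.
pose decided n := \forall B \near A,
  saturated P (cset B) -> cset B `&` b n = cset A `&` b n.
pose U N : set G := \bigcup_(n in [set n | (n < N)%N /\ decided n]) b n.
have mU N : measurable (U N : set (borel G)).
  by apply: open_borel; apply: bigcup_open => n _; exact: ob.
have U_cvg : {ae mu, forall x, \forall N \near \oo, ~ (~` U N) x}.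
  have [Z [mZ Z0 AZ]] := saturated_boundary_null mu P1 Pint sA.
  exists Z; split=> // x nUx; apply: AZ; apply: contrapT => nbx; apply: nUx.
  have [W [nW AW]] := saturated_near_eq P1 Pint sA nbx.
  have [n bnx bnW] := bb _ _ nW.
  have dn : decided n.
    apply: filterS AW => B BW /BW BAW.
    by rewrite -(setIidr bnW) !setIA BAW.
  by exists n.+1 => // N /= nN; apply; exists n.
(* Dominated convergence is applied to the sequence of complements of [U N], not along the filter
   [nbhs A]. Once [N] is fixed, only finitely many decided basic sets matter, so agreement with [A]
   on [U N] holds for all saturated sets near [A]. *)
have intD := Rintegral_vanishing (fun N => measurableC (mU N)) U_cvg gi.
have [N _ /(_ N (leqnn N)) DNe] : \forall N \near \oo,
    \int[mu]_(x in ~` U N) `|g x| < e.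
  by move: intD => /cvgr_lt; exact.
have : \forall B \near A, saturated P (cset B) ->
    cset B `&` U N = cset A `&` U N.
  elim: N {DNe} => [|N IHN].
    apply: (@filterE _ (nbhs A)) => B _.
    suff -> : U 0%N = set0 by rewrite !setI0.
    by apply/seteqP; split=> // x [n []].
  have US : U N.+1 = U N `|` (if `[< decided N >] then b N else set0).
    apply/seteqP; split=> [x [n [nN dn] bnx]|x [[n [nN dn] bnx]|]].
    - move: nN; rewrite ltnS leq_eqVlt => /predU1P[nN|nN].
        by right; rewrite -nN asboolT.
      by left; exists n.
    - by exists n => //; split=> //; exact: ltnW.
    - by case: asboolP => // dN bNx; exists N.
  case: asboolP US => dN US.
    apply: filterS2 IHN dN => B BN bN sB.
    by rewrite US !setIUr BN// bN.
  by apply: filterS IHN => B BN sB; rewrite US setU0 BN.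
apply: filterS => B BU sB; apply: le_lt_trans DNe.
apply: Rintegral_indicB_le => //.
- exact: closed_borel.
- exact: closed_borel.
- exact: measurableC.
- by rewrite !setDE setCK BU.
Qed.

Lemma indic_LinfE (A : closedSet G) :
  ae_eq mu setT (indic_Linf mu A : _ -> R) (\1_(cset A)).
Proof. exact: Linf_classE. Qed.

Lemma pairing_indicE (A : closedSet G) (g : L1 mu) :
  pairing (indic_Linf mu A) g = \int[mu]_x (\1_(cset A) x * (g : _ -> R) x).
Proof.
apply: pairingE.
- exact: closed_indic_measurable.
- exact: L1_measurable.
- exact: indic_LinfE.
- exact: ae_eq_refl.
Qed.

Hypothesis PM : forall x y : G, cset P x -> cset P y -> cset P (x * y)%g.
Let X := order_compactification P.

(** The weak* topology is initial for [pairing] into the pointwise topology, so one [g] can be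
    tested at a time. *)
Lemma indic_Linf_continuous :
  {within X, continuous (indic_Linf mu : closedSet G -> Linf_weakstar mu)}.
Proof.
apply: continuous_comp_initial; apply/subspace_continuousP => A XA.
have sA := order_compactification_saturated PM XA.
have cvg_pairing (g : L1 mu) :
    pairing (indic_Linf mu B) g @[B --> within X (nbhs A)] -->
    (pairing (indic_Linf mu A) g : R).
  apply/cvgrPdist_lt => e e0.
  apply: filterS (Rintegral_indic_cvg sA (L1_integrable g) e0) => B hB XB.
  rewrite /= !pairing_indicE; apply: hB.
  exact: order_compactification_saturated XB.
apply/cvg_sup => g V [_ [[W oW <-] WA WV]]; apply: filterS WV _.
by apply: (cvg_pairing g W); exact: open_nbhs_nbhs.
Qed.

Lemma indic_Linf_inj : {in X &, injective (indic_Linf mu)}.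
Proof.
have sub A B : X A -> indic_Linf mu A = indic_Linf mu B -> cset A `<=` cset B.
  move=> XA AB; have sA := order_compactification_saturated PM XA.
  have ABae : ae_eq mu setT (\1_(cset A) : _ -> R) (\1_(cset B)).
    apply: ae_eq_trans (ae_eq_sym (indic_LinfE A)) _.
    by rewrite AB; exact: indic_LinfE.
  (* The two indicators differ on this open set, so it is null and therefore empty. *)
  have oAB : open ((cset A)° `&` ~` cset B).
    by apply: openI; [exact: open_interior|exact/closed_openC/cset_closed].
  have AB0 : (cset A)° `&` ~` cset B = set0.
    apply/eqP/negPn/negP => /set0P/(haar_open_gt0 mu oAB).
    suff -> : mu ((cset A)° `&` ~` cset B) = 0%E by rewrite ltxx.
    apply/negligibleP; first exact: open_borel.
    apply: negligibleS ABae => x [/interior_subset Ax nBx] /= /(_ I).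
    rewrite !indicE mem_set// memNset// => /eqP.
    by rewrite oner_eq0.
  apply: subset_trans (saturated_regular P1 Pint sA) _.
  rewrite (closure_id (cset B)).1; last exact: cset_closed.
  apply: closureS => x Ax; apply: contrapT => nBx.
  by have : set0 x by rewrite -AB0.
move=> A B /set_mem XA /set_mem XB AB; apply: closedSet_inj; apply/seteqP.
by split; apply: sub.
Qed.

(** The topology is pulled back along the injection [pairing] from a product of real lines. *)
Lemma Linf_weakstar_hausdorff : hausdorff_space (Linf_weakstar mu).
Proof.
move=> f h fh; apply: (pairing_inj (haar_sigma_finite mu)).
have hR : hausdorff_space {ptws L1 mu -> R}.
  by apply: hausdorff_product => _; exact: Rhausdorff.
apply: hR => U V /initial_continuous fU /initial_continuous hV.
by have [k [Uk Vk]] := fh _ _ fU hV; exists (pairing k).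
Qed.

Lemma order_compactification_compact : compact X.
Proof.
apply: (subclosed_compact _ (@closedSet_compact G)) => //.
exact: closed_closure.
Qed.

(** The complement of [A] carries no mass of the restricted measure, while an open set meeting [A]
    meets its interior in a nonempty open set, of positive measure. *)
Lemma order_compactification_solid A : X A -> solid mu (cset A).
Proof.
move=> /(order_compactification_saturated PM) sA.
have Areg := saturated_regular P1 Pint sA; split=> //.
apply/seteqP; split=> x.
  move=> Ax; apply: contrapT => nAx.
  have oA : open (~` cset A) by exact/closed_openC/cset_closed.
  by have := Ax _ oA nAx; rewrite setICl measure0 ltxx.
move=> Ax U oU Ux.
have [y [Ay Uy]] := Areg _ Ax U (open_nbhs_nbhs (conj oU Ux)).
have oUA : open (U `&` (cset A)°) by apply: openI => //; exact: open_interior.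
apply: (@lt_le_trans _ _ (mu (U `&` (cset A)°))).
  by apply: haar_open_gt0 => //; exists y.
rewrite le_measure ?inE//; first exact: open_borel.
  by apply: measurableI; [exact: open_borel|exact: closed_borel].
by apply: setIS; exact: interior_subset.
Qed.

End embedding.

Theorem proposition5p7 (R : realType) (G : lcscGroupType)
    (mu : haarMeasure R G) (P : closedSet G)
    (P1 : cset P 1%g)
    (PM : forall x y : G, cset P x -> cset P y -> cset P (x * y)%g)
    (PPV : forall g : G, exists x y : G,
       [/\ cset P x, cset P y & g = (x * y^-1)%g])
    (Pint : cset P `<=` closure (cset P)°) :
  (topological_embedding (order_compactification P)
     (indic_Linf mu : closedSet G -> Linf_weakstar mu) /\
   forall (A : closedSet G) (a : G),
     order_compactification P A -> cset P a ->
     indic_Linf mu (cset_rmul A a) = rtranslate a (indic_Linf mu A)) /\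
  condition_M mu P.
Proof.
set X := order_compactification P.
have cf := indic_Linf_continuous (mu := mu) P1 Pint PM.
(* Used twice: with [C] the complement of an open set, for the inverse map, and with [C] the whole
   space, for closedness of the image. *)
have fcompact C : closed C ->
    compact ((indic_Linf mu : _ -> Linf_weakstar mu) @` (X `&` C)).
  move=> cC; apply: continuous_compact.
    by apply: continuous_subspaceW cf; exact: subIsetl.
  by apply: compact_closedI => //; exact: order_compactification_compact.
have finj := indic_Linf_inj (mu := mu) P1 Pint PM.
split; first split.
- split=> // U oU.
  (* The witness removes the compact image of the part of [X] outside [U]; by injectivity no image
     of a point of [U] in [X] is lost. *)
  exists (~` ((indic_Linf mu : _ -> Linf_weakstar mu) @` (X `&` ~` U))).
    apply/closed_openC; apply: compact_closed.
      exact: Linf_weakstar_hausdorff.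
    by apply: fcompact; exact: open_closedC.
  apply/seteqP; split=> [_ [A [XA UA] <-]|_ [[A XA <-] nA]].
    split; first by exists A.
    move=> [B [XB nUB] /(finj _ _ (mem_set XB) (mem_set XA)) BA].
    by rewrite BA in nUB.
  by exists A => //; split=> //; apply: contrapT => nUA; apply: nA; exists A.
- move=> A a _ _; apply/Linf_eqP.
  apply: ae_eq_trans (Linf_classE _) _; apply/ae_eq_sym.
  apply: ae_eq_trans (rtranslate_classE _ _) _.
  apply: aeW => x _ /=; rewrite /closed_indic /= !indicE.
  congr (nat_of_bool _)%:R.
  by apply/idP/idP => /set_mem h; apply/mem_set; move: h; rewrite rmul_setE.
- move=> f clf.
  (* The image of [X] is weak* closed and contains the indicators of the translates, hence also
     their closure. *)
  have : ((indic_Linf mu : _ -> Linf_weakstar mu) @` (X `&` setT)) f.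
    have /compact_closed := fcompact _ closedT.
    move=> /(_ (@Linf_weakstar_hausdorff _ _ mu)) /closure_id ->.
    apply: closureS clf => _ [A PA <-]; exists A => //; split=> //.
    exact: subset_closure.
  move=> [A [XA _] <-]; exists A => //.
  exact: order_compactification_solid XA.
Qed.
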